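(* Let $G$ be a group such that every $g\in G\setminus \mathrm{Z}(G)$ of infinite order has infinite conjugacy class. Let $A$ be a torsion-free abelian group and assume that $G$ embeds into a direct product $A\times K$, for some group $K$, as a subgroup of finite index. Moreover, suppose that $\mathrm{Z}(G)$ embeds into $A$. Let $\varphi$ be an existential formula with free variable $x$, so $\varphi$ is equivalent to $$\exists\overline{y}:\bigvee_{j=1}^m \left(w_{j,1}(x,\overline{y})\#_{j,1} 1\wedge\cdots\wedge w_{j,k_j}(x,\overline{y})\#_{j,k_j}1\right),$$ where every $w_{j,i}$ is a word, $m$ is a positive integer, and $\#_{j,i}\in \{=, \neq\}$. Then $\varphi$ is concise in $G$.
   Context: A formula is a first-order formula $\varphi(x)$ in the language of groups $\{1,\cdot,{}^{-1}\}$ with one free variable $x$ and without parameters. It is existential if the existential quantifier is the only quantifier occurring in it. For a group $G$, $G_\varphi:=\{g\in G\mid\varphi(g)\text{ is true}\}$ and $\varphi(G):=\langle G_\varphi\rangle$ is the subgroup generated by $G_\varphi$. A formula $\varphi$ is concise in a group $G$ if finiteness of $G_\varphi$ implies finiteness of $\varphi(G)$. $\mathrm{Z}(G)$ denotes the centre of $G$.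
   Formalization: ''Z(G) embeds into A'' is taken to mean that the given embedding of G into A×K, followed by projection to A, is injective on Z(G); with an arbitrary unrelated embedding of Z(G) into A the claim fails. *)

(* Defs.v *)
From HB Require Import structures.
From mathcomp Require Import all_boot.
From mathcomp Require Import boolp classical_sets functions cardinality.

Set Implicit Arguments.
Unset Strict Implicit.
Unset Printing Implicit Defensive.

Local Open Scope group_scope.
Local Open Scope classical_set_scope.

(* First-order logic in the language {1, *, ^-1}.  [formula n] consists of the *)
(* parameter-free formulas whose free variables are among x_0, ..., x_(n-1),  *)
(* so a formula with the single free variable x is a [formula 1].             *)
Inductive term (n : nat) : Type :=
  | Var of 'I_n
  | One
  | Mul of term n & term n
  | Inv of term n.

(* A quantifier over [formula n.+1] binds variable 0; variable i.+1 of the    *)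
(* body is variable i of the quantified formula.                              *)
Inductive formula : nat -> Type :=
  | Eq n : term n -> term n -> formula n
  | Not n : formula n -> formula n
  | And n : formula n -> formula n -> formula n
  | Or n : formula n -> formula n -> formula n
  | Exists n : formula n.+1 -> formula n
  | Forall n : formula n.+1 -> formula n.

Fixpoint eval (G : groupType) n (e : 'I_n -> G) (t : term n) : G :=
  match t with
  | Var i => e i
  | One => 1
  | Mul t1 t2 => eval e t1 * eval e t2
  | Inv t1 => (eval e t1)^-1
  end.

Definition env_cons (T : Type) n (a : T) (e : 'I_n -> T) : 'I_n.+1 -> T :=
  fun i => oapp e a (unlift ord0 i).

Fixpoint sat (G : groupType) n (phi : formula n) : ('I_n -> G) -> Prop :=
  match phi in formula n return ('I_n -> G) -> Prop with
  | Eq _ s t => fun e => eval e s = eval e t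
  | Not _ p => fun e => ~ sat p e
  | And _ p q => fun e => sat p e /\ sat q e
  | Or _ p q => fun e => sat p e \/ sat q e
  | Exists _ p => fun e => exists a : G, sat p (env_cons a e)
  | Forall _ p => fun e => forall a : G, sat p (env_cons a e)
  end.

Fixpoint quantifier_free n (phi : formula n) : bool :=
  match phi with
  | Eq _ _ _ => true
  | Not _ p => quantifier_free p
  | And _ p q | Or _ p q => quantifier_free p && quantifier_free q
  | Exists _ _ | Forall _ _ => false
  end.

(* Existential quantifiers only; a negated one is a universal quantifier in   *)
(* disguise, so negation is applied to quantifier-free formulas only.  See    *)
(* [existential_normal_form] below.                                           *)
Fixpoint existential n (phi : formula n) : bool :=
  match phi with
  | Eq _ _ _ => true
  | Not _ p => quantifier_free p
  | And _ p q | Or _ p q => existential p && existential q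
  | Exists _ p => existential p
  | Forall _ _ => false
  end.

Definition is_subgroup (G : groupType) (H : set G) : Prop :=
  [/\ H 1, forall x y, H x -> H y -> H (x * y) & forall x, H x -> H x^-1].

Definition generated (G : groupType) (S : set G) : set G :=
  smallest (@is_subgroup G) S.

Definition definable_set (G : groupType) (phi : formula 1) : set G :=
  [set g | sat phi (fun=> g)].
Arguments definable_set : clear implicits.

Definition formula_subgroup (G : groupType) (phi : formula 1) : set G :=
  generated (definable_set G phi).
Arguments formula_subgroup : clear implicits.

Definition concise (phi : formula 1) (G : groupType) : Prop :=
  finite_set (definable_set G phi) -> finite_set (formula_subgroup G phi).

Definition center (G : groupType) : set G := [set z | forall g, commute z g].
Arguments center : clear implicits.

Definition conjugacy_class (G : groupType) (x : G) : set G :=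
  [set x ^ g | g in [set: G]].

Definition infinite_order (G : groupType) (x : G) : Prop :=
  forall n, (0 < n)%N -> x ^+ n <> 1.

Definition torsion_free (G : groupType) : Prop :=
  forall x : G, x <> 1 -> infinite_order x.

Definition finite_index (G : groupType) (H : set G) : Prop :=
  finite_set (range (fun x : G => [set x * h | h in H])).

(* Normal form of existential formulas.  A letter (v, false) stands for v,    *)
(* (v, true) for v^-1; a literal (w, true) stands for w = 1, (w, false) for   *)
(* w <> 1; a sequence of sequences of literals is a disjunction of            *)
(* conjunctions.                                                              *)
Definition word (V : Type) := seq (V * bool).
Definition dnf (V : Type) := seq (seq (word V * bool)).

Definition eval_word (G : groupType) (V : Type) (e : V -> G) (w : word V) : G :=
  \prod_(l <- w) (if l.2 then (e l.1)^-1 else e l.1).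

Definition literal_sat (G : groupType) (V : Type) (e : V -> G)
  (l : word V * bool) : Prop :=
  if l.2 then eval_word e l.1 = 1 else eval_word e l.1 <> 1.

Definition dnf_sat (G : groupType) (V : eqType) (e : V -> G) (D : dnf V) : Prop :=
  exists2 C, C \in D & forall l, l \in C -> literal_sat e l.

Definition env_sum (T A B : Type) (e : A -> T) (y : B -> T) (v : A + B) : T :=
  match v with inl i => e i | inr j => y j end.

Fixpoint word_of n (t : term n) : word 'I_n :=
  match t with
  | Var i => [:: (i, false)]
  | One => [::]
  | Mul s t => word_of s ++ word_of t
  | Inv s => rev [seq (l.1, ~~ l.2) | l <- word_of s]
  end.

Definition rename (V W : Type) (f : V -> W) (D : dnf V) : dnf W :=
  [seq [seq ([seq (f a.1, a.2) | a <- l.1], l.2) | l <- C] | C <- D].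

Definition dnf_and (V : Type) (D1 D2 : dnf V) : dnf V :=
  [seq C1 ++ C2 | C1 <- D1, C2 <- D2].

Lemma eval_word_inv (G : groupType) (V : Type) (e : V -> G) (w : word V) :
  eval_word e (rev [seq (l.1, ~~ l.2) | l <- w]) = (eval_word e w)^-1.
Proof.
rewrite /eval_word; elim: w => [|[v b] w IH] /=; first by rewrite !big_nil invg1.
rewrite rev_cons -cats1 big_cat big_seq1 big_cons /= IH invgM.
by case: b; rewrite //= invgK.
Qed.

Lemma eval_word_of (G : groupType) n (e : 'I_n -> G) (t : term n) :
  eval_word e (word_of t) = eval e t.
Proof.
elim: t => [i||s IHs t IHt|s IHs] /=.
- by rewrite /eval_word big_seq1.
- by rewrite /eval_word big_nil.
- by rewrite -IHs -IHt /eval_word big_cat.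
- by rewrite eval_word_inv IHs.
Qed.

Lemma dnf_sat_cat (G : groupType) (V : eqType) (e : V -> G) (D1 D2 : dnf V) :
  dnf_sat e (D1 ++ D2) <-> dnf_sat e D1 \/ dnf_sat e D2.
Proof.
split=> [[C]|[] [C CD H]]; last 2 first.
- by exists C; rewrite // mem_cat CD.
- by exists C; rewrite // mem_cat CD orbT.
by rewrite mem_cat => /orP[] CD H; [left|right]; exists C.
Qed.

Lemma dnf_sat_and (G : groupType) (V : eqType) (e : V -> G) (D1 D2 : dnf V) :
  dnf_sat e (dnf_and D1 D2) <-> dnf_sat e D1 /\ dnf_sat e D2.
Proof.
split=> [[C /allpairsP[[C1 C2] /= [CD1 CD2 ->]] H]|[[C1 CD1 H1] [C2 CD2 H2]]].
  by split; [exists C1|exists C2] => // l lC; apply: H; rewrite mem_cat lC ?orbT.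
exists (C1 ++ C2); first exact: allpairs_f.
by move=> l; rewrite mem_cat => /orP[/H1|/H2].
Qed.

Lemma dnf_sat_rename (G : groupType) (V W : eqType) (f : V -> W) (e : W -> G)
  (D : dnf V) : dnf_sat e (rename f D) <-> dnf_sat (e \o f) D.
Proof.
have lE l : literal_sat e ([seq (f a.1, a.2) | a <- l.1], l.2) <->
            literal_sat (e \o f) l.
  by case: l => w b; rewrite /literal_sat /eval_word /= big_map.
split=> [[_ /mapP[C CD ->] H]|[C CD H]].
  by exists C => // l lC; apply/lE/H/map_f.
by eexists; [exact: map_f CD|move=> _ /mapP[l lC ->]; apply/lE/H].
Qed.

Lemma dnf_and_neq0 (V : Type) (D1 D2 : dnf V) :
  D1 <> [::] -> D2 <> [::] -> dnf_and D1 D2 <> [::].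
Proof. by case: D1 D2 => [|C1 D1] [|C2 D2]. Qed.

Lemma quantifier_free_normal_form n (phi : formula n) (b : bool) :
  quantifier_free phi ->
  exists2 D : dnf 'I_n, D <> [::] & forall (G : groupType) (e : 'I_n -> G),
    (if b then sat phi e else ~ sat phi e) <-> dnf_sat e D.
Proof.
elim: phi b => [{}n s t|{}n p IH|{}n p IHp q IHq|{}n p IHp q IHq|//|//] b /=.
- move=> _; exists [:: [:: (word_of (Mul s (Inv t)), b)]] => // G e.
  have E : literal_sat e (word_of (Mul s (Inv t)), b) <->
      (if b then eval e s = eval e t else eval e s <> eval e t).
    rewrite /literal_sat eval_word_of /=.
    have -> : (eval e s / eval e t = 1) = (eval e s = eval e t).
      by apply/propext; split=> [/eqP|/eqP h]; [rewrite divg_eq1 => /eqP|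
         apply/eqP; rewrite divg_eq1].
    by [].
  rewrite -E; split=> [h|[C]]; last by rewrite inE => /eqP-> ; apply; rewrite inE.
  by exists [:: (word_of (Mul s (Inv t)), b)]; rewrite ?inE// => l; rewrite inE => /eqP->.
- move=> /(IH (~~ b))[D D0 h]; exists D => // G e; rewrite -h.
  by case: b {h} => //=; split=> [/contrapT|hp /(_ hp)].
- move=> /andP[/(IHp b)[D1 D10 h1] /(IHq b)[D2 D20 h2]].
  case: b h1 h2 => h1 h2.
    exists (dnf_and D1 D2); first exact: dnf_and_neq0.
    by move=> G e; rewrite dnf_sat_and -h1 -h2.
  exists (D1 ++ D2); first by case: D1 D10 {h1}.
  by move=> G e; rewrite dnf_sat_cat -h1 -h2 not_andP.
- move=> /andP[/(IHp b)[D1 D10 h1] /(IHq b)[D2 D20 h2]].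
  case: b h1 h2 => h1 h2.
    exists (D1 ++ D2); first by case: D1 D10 {h1}.
    by move=> G e; rewrite dnf_sat_cat -h1 -h2.
  exists (dnf_and D1 D2); first exact: dnf_and_neq0.
  by move=> G e; rewrite dnf_sat_and -h1 -h2 not_orP.
Qed.

Lemma existential_normal_form n (phi : formula n) :
  existential phi ->
  exists k, exists2 D : dnf ('I_n + 'I_k)%type, D <> [::] &
    forall (G : groupType) (e : 'I_n -> G),
      sat phi e <-> exists y : 'I_k -> G, dnf_sat (env_sum e y) D.
Proof.
have qf m (p : formula m) : quantifier_free p ->
    exists k, exists2 D : dnf ('I_m + 'I_k)%type, D <> [::] &
    forall (G : groupType) (e : 'I_m -> G),
      sat p e <-> exists y : 'I_k -> G, dnf_sat (env_sum e y) D.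
  move=> /(quantifier_free_normal_form true)[D D0 h].
  exists 0, (rename inl D); first by case: D D0 {h}.
  move=> G e; rewrite h; split=> [hD|[y]]; last by rewrite dnf_sat_rename.
  by exists (fun=> 1); rewrite dnf_sat_rename.
pose ren1 m k1 k2 (v : 'I_m + 'I_k1) : 'I_m + 'I_(k1 + k2) :=
  match v with inl i => inl i | inr j => inr (lshift k2 j) end.
pose ren2 m k1 k2 (v : 'I_m + 'I_k2) : 'I_m + 'I_(k1 + k2) :=
  match v with inl i => inl i | inr j => inr (rshift k1 j) end.
have e1 (G : groupType) m k1 k2 (e : 'I_m -> G) (y : 'I_(k1 + k2) -> G) :
    env_sum e y \o @ren1 m k1 k2 = env_sum e (y \o lshift k2).
  by apply/funext => -[].
have e2 (G : groupType) m k1 k2 (e : 'I_m -> G) (y : 'I_(k1 + k2) -> G) :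
    env_sum e y \o @ren2 m k1 k2 = env_sum e (y \o @rshift k1 k2).
  by apply/funext => -[].
pose glue (G : groupType) k1 k2 (y1 : 'I_k1 -> G) (y2 : 'I_k2 -> G) i :=
  match fintype.split i with inl j => y1 j | inr j => y2 j end.
have g1 (G : groupType) k1 k2 (y1 : 'I_k1 -> G) (y2 : 'I_k2 -> G) :
    glue G k1 k2 y1 y2 \o lshift k2 = y1.
  by apply/funext => j; rewrite /glue /= (unsplitK (inl j)).
have g2 (G : groupType) k1 k2 (y1 : 'I_k1 -> G) (y2 : 'I_k2 -> G) :
    glue G k1 k2 y1 y2 \o @rshift k1 k2 = y2.
  by apply/funext => j; rewrite /glue /= (unsplitK (inr j)).
have map0 (V W : Type) (f : V -> W) (D : dnf V) : D <> [::] -> rename f D <> [::].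
  by case: D.
elim: phi => [{}n s t|{}n p _|{}n p IHp q IHq|{}n p IHp q IHq|{}n p IHp|//] /=.
- by move=> _; exact: (qf _ (Eq s t)).
- by move=> hp; exact: (qf _ (Not p)).
- move=> /andP[/IHp[k1 [D1 D10 h1]] /IHq[k2 [D2 D20 h2]]].
  exists (k1 + k2)%N, (dnf_and (rename (@ren1 n k1 k2) D1) (rename (@ren2 n k1 k2) D2)).
    by apply: dnf_and_neq0; apply: map0.
  move=> G e; rewrite h1 h2; split=> [[[y1 hy1] [y2 hy2]]|[y]].
    by exists (glue G k1 k2 y1 y2); rewrite dnf_sat_and !dnf_sat_rename e1 e2 g1 g2.
  rewrite dnf_sat_and !dnf_sat_rename e1 e2 => -[hy1 hy2].
  by split; eexists; eassumption.
- move=> /andP[/IHp[k1 [D1 D10 h1]] /IHq[k2 [D2 D20 h2]]].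
  exists (k1 + k2)%N, (rename (@ren1 n k1 k2) D1 ++ rename (@ren2 n k1 k2) D2).
    by case: D1 D10 {h1}.
  move=> G e; rewrite h1 h2; split=> [[[y1 hy1]|[y2 hy2]]|[y]].
  + exists (glue G k1 k2 y1 (fun=> 1)).
    by rewrite dnf_sat_cat !dnf_sat_rename e1 e2 g1 g2; left.
  + exists (glue G k1 k2 (fun=> 1) y2).
    by rewrite dnf_sat_cat !dnf_sat_rename e1 e2 g1 g2; right.
  + rewrite dnf_sat_cat !dnf_sat_rename e1 e2 => -[] hy; [left|right];
    by eexists; eassumption.
- move=> /IHp[k [D D0 h]].
  pose f (v : 'I_n.+1 + 'I_k) : 'I_n + 'I_k.+1 :=
    match v with
    | inl i => oapp inl (inr ord0) (unlift ord0 i)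
    | inr j => inr (lift ord0 j)
    end.
  have fE (G : groupType) (e : 'I_n -> G) (y : 'I_k.+1 -> G) :
      env_sum e y \o f = env_sum (env_cons (y ord0) e) (y \o lift ord0).
    by apply/funext => -[i|j] //=; rewrite /env_cons; case: unliftP.
  exists k.+1, (rename f D); first exact: map0.
  move=> G e; split=> [[a /h[y hy]]|[y]].
    exists (env_cons a y); rewrite dnf_sat_rename fE.
    have -> : env_cons a y ord0 = a by rewrite /env_cons unlift_none.
    suff -> : env_cons a y \o lift ord0 = y by [].
    by apply/funext => j; rewrite /env_cons /= liftK.
  by rewrite dnf_sat_rename fE => hy; exists (y ord0); apply/h; eexists; exact: hy.
Qed.

(* Main.v *)
(* Choose N > 0 with x^N in G for all x in A * K.  Then (a, k) |-> (a^(N+1),  *)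
(* k) is an injective endomorphism of G.  Existential formulas are kept by    *)
(* embeddings, so an element of G_phi with nontrivial A-component would have  *)
(* infinitely many images in G_phi.  Hence, if G_phi is finite, it lies in    *)
(* 1 * K, which meets Z(G) trivially; as its elements have finite conjugacy   *)
(* classes, they have finite order, and Dietzmann's lemma applies.            *)
Require Import Defs.
From HB Require Import structures.
From mathcomp Require Import all_boot.
From mathcomp Require Import boolp classical_sets functions cardinality.

Local Open Scope group_scope.
Local Open Scope classical_set_scope.

(** Two facts carry the proof. An injective endomorphism of [G] maps the solutions of an existential
    formula to solutions ([definable_set_endo]), as it transports witnesses and both preserves and
    reflects equations. A finite conjugation-closed set of torsion elements generates a finite group
    ([dietzmann]). Conjugations supply the closure; the endomorphism raising A-components to a
    power, available by [finite_index_exponent], forces the solutions into the kernel of the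
    projection to [A], where the hypotheses on [G] leave only torsion. *)

Lemma morphg1 {G H : groupType} {f : G -> H} :
  {morph f : x y / x * y} -> f 1 = 1.
Proof. by move=> fM; apply: (mulgI (f 1)); rewrite -fM !mulg1. Qed.

Lemma morphgV {G H : groupType} {f : G -> H} :
  {morph f : x y / x * y} -> {morph f : x / x^-1}.
Proof.
by move=> fM x; apply: (mulgI (f x)); rewrite -fM !mulgV (morphg1 fM).
Qed.

Lemma subgroupX {G : groupType} {H : set G} x n :
  is_subgroup H -> H x -> H (x ^+ n).
Proof.
by move=> [H1 HM _] Hx; elim: n => // n IH; rewrite expgS; apply: HM.
Qed.

Lemma range_subgroup {G H : groupType} {f : G -> H} :
  {morph f : x y / x * y} -> is_subgroup (range f).
Proof.
move=> fM; split; first by exists 1; rewrite ?(morphg1 fM).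
- by move=> _ _ [x _ <-] [y _ <-]; exists (x * y); rewrite ?fM.
- by move=> _ [x _ <-]; exists x^-1; rewrite ?(morphgV fM).
Qed.

(** Among the cosets of x^0, ..., x^m, with m the number of cosets, two coincide. Hence x^d lies in
    [H] for some 0 < d <= m, and d divides m!. Normality of [H] is not assumed. *)
Lemma finite_index_exponent {G : groupType} {H : set G} :
  is_subgroup H -> finite_index H ->
  exists2 n, 0 < n & forall x, H (x ^+ n).
Proof.
move=> Hsub /finite_seqP[s sE]; have [H1 HM HV] := Hsub.
exists (size s)`!; first exact: fact_gt0.
move=> x; pose F i : set G := [set x ^+ i * h | h in H].
have Fs i : F i \in s.
  by have : [set` s] (F i) by rewrite -sE; exists (x ^+ i).
suff [i [j [ij js /esym FE]]] :
    exists i, exists j, [/\ i < j, j <= size s & F i = F j].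
  have [h Hh xE] : F i (x ^+ j) by rewrite -FE; exists 1; rewrite ?mulg1.
  have Hji : H (x ^+ (j - i)).
    rewrite (_ : x ^+ (j - i) = h) //; apply: (mulgI (x ^+ i)).
    by rewrite -expgnDr subnKC ?(ltnW ij).
  have /dvdnP[q ->] : j - i %| (size s)`!.
    by apply: dvdn_fact; rewrite subn_gt0 ij (leq_trans (leq_subr _ _) js).
  by rewrite mulnC expgnA; apply: subgroupX.
have /(uniqPn set0)[i [j []]] : ~~ uniq (mkseq F (size s).+1).
  apply/negP => /uniq_leq_size/(_ (_ : {subset _ <= s})).
  rewrite size_mkseq ltnn => nsub.
  by have /nsub : {subset mkseq F (size s).+1 <= s} by move=> _ /mapP[i _ ->].
rewrite size_mkseq ltnS => ij js; rewrite !nth_mkseq ?ltnS //; last first.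
  exact: leq_trans (ltnW ij) js.
by exists i, j.
Qed.

Section Embedding.
Context {G H : groupType} {f : G -> H}.
Context (fM : {morph f : x y / x * y}) (f_inj : injective f).

Lemma eval_morph n (e : 'I_n -> G) t : eval (f \o e) t = f (eval e t).
Proof.
elim: t => [i||s IHs t IHt|s IHs] //=; first by rewrite (morphg1 fM).
  by rewrite IHs IHt fM.
by rewrite IHs (morphgV fM).
Qed.

(** Injectivity reflects equations; having both directions lets the induction pass through
    negation. *)
Lemma sat_quantifier_free_embedding n (p : formula n) :
  quantifier_free p -> forall e, sat p (f \o e) <-> sat p e.
Proof.
elim: p => [{}n s t|{}n p IH|{}n p IHp q IHq|{}n p IHp q IHq|//|//] /=.
- by move=> _ e; rewrite !eval_morph; split=> [/f_inj|->].
- by move=> /IH {}IH e; rewrite IH.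
- by move=> /andP[/IHp {}IHp /IHq {}IHq] e; rewrite IHp IHq.
- by move=> /andP[/IHp {}IHp /IHq {}IHq] e; rewrite IHp IHq.
Qed.

Lemma sat_existential_embedding n (p : formula n) :
  existential p -> forall e, sat p e -> sat p (f \o e).
Proof.
elim: p => [{}n s t|{}n p _|{}n p IHp q IHq|{}n p IHp q IHq|{}n p IHp|//] /=.
- by move=> _ e; rewrite !eval_morph => ->.
- by move=> qp e; rewrite sat_quantifier_free_embedding.
- by move=> /andP[/IHp {}IHp /IHq {}IHq] e [/IHp ? /IHq].
- by move=> /andP[/IHp {}IHp /IHq {}IHq] e [/IHp|/IHq]; [left|right].
- move=> /IHp {}IHp e [a /IHp h]; exists (f a).
  rewrite (_ : env_cons _ _ = f \o env_cons a e) //.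
  by apply/funext => i; rewrite /env_cons /=; case: (unlift ord0 i).
Qed.

End Embedding.

Lemma definable_set_endo {G : groupType} {phi : formula 1} {f : G -> G} :
  existential phi -> {morph f : x y / x * y} -> injective f ->
  forall g, definable_set G phi g -> definable_set G phi (f g).
Proof. by move=> ephi fM f_inj g; apply: sat_existential_embedding. Qed.

Lemma definable_setJ {G : groupType} {phi : formula 1} :
  existential phi ->
  forall g x, definable_set G phi g -> definable_set G phi (g ^ x).
Proof.
move=> ephi g x; apply: (definable_set_endo (f := fun y => y ^ x)) => //.
  by move=> y z; rewrite conjMg.
exact: conjg_inj.
Qed.

(** Pigeonhole for [dietzmann]: a long word over a finite alphabet repeats some letter often. *)
Lemma size_le_sum_count {T : eqType} {s w : seq T} :
  {subset w <= s} -> size w <= (\sum_(x <- s) count_mem x w)%N.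
Proof.
elim: w => [|y w IH] ws //=; rewrite big_split /= -add1n leq_add //.
  by rewrite (big_rem y) ?ws ?mem_head //= eqxx.
by apply: IH => z zw; apply: ws; rewrite inE zw orbT.
Qed.

Lemma finite_torsion_exponent {G : groupType} {X : set G} :
  finite_set X -> (forall x, X x -> ~ infinite_order x) ->
  exists2 n, 0 < n & forall x, X x -> x ^+ n = 1.
Proof.
move=> /finite_seqP[s ->] Xtor.
have /choice[o oP] : forall x, exists m, x \in s -> 0 < m /\ x ^+ m = 1.
  move=> x; have [xs|_] := boolP (x \in s); last by exists 0.
  apply: contrapT => h; apply: (Xtor x xs) => m m0 xm.
  by apply: h; exists m.
(* [o] may vanish outside [s], so positivity is checked on members of [s] only. *)
exists (\prod_(x <- s) o x)%N.
  rewrite big_seq; elim/big_ind: _ => // [a b|x /oP[]//].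
  by rewrite muln_gt0 => -> ->.
move=> x /= xs; have [_ ox] := oP x xs.
by rewrite (big_rem x) //= expgnA ox expg1n.
Qed.

Section Dietzmann.
Context {G : groupType} {X : set G}.
Context (XJ : forall x y, X x -> X (x ^ y)).

(* The copies of x move to the front, conjugating the letters they pass.      *)
Lemma word_collect {x n} {w : seq G} :
  [set` w] `<=` X -> n <= count_mem x w ->
  exists w', [/\ [set` w'] `<=` X, size w = n + size w' &
    \prod_(y <- w) y = x ^+ n * \prod_(y <- w') y].
Proof.
elim: w n => [|y w IH] n wX.
  by rewrite /= leqn0 => /eqP->; exists [::]; rewrite expg0 mul1g.
have Xy : X y by apply: wX; rewrite /= mem_head.
have {}wX : [set` w] `<=` X.
  by move=> z /= zw; apply: wX; rewrite /= inE zw orbT.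
case: n => [_|n]; first exists (y :: w).
  by rewrite expg0 mul1g; split=> // z /=; rewrite inE => /orP[/eqP->|/wX].
rewrite /= big_cons; have [->|nyx] := eqVneq y x.
  rewrite add1n ltnS => /(IH _ wX)[w' [w'X -> ->]].
  by exists w'; rewrite expgS mulgA.
rewrite add0n => /(IH _ wX)[w' [w'X -> ->]].
exists (y ^ (x ^+ n.+1) :: w'); rewrite big_cons mulgA (conjgC y) -mulgA /= addnS.
by split=> // z /=; rewrite inE => /orP[/eqP->|/w'X //]; apply: XJ.
Qed.

Lemma short_words_finite n :
  finite_set X ->
  finite_set [set \prod_(y <- w) y | w in
    [set w : seq G | [set` w] `<=` X /\ size w <= n]].
Proof.
move=> Xfin; elim: n => [|n IH].
  apply: (sub_finite_set _ (finite_set1 (1 : G))) => _ [w [_ w0] <-].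
  by move: w0; rewrite leqn0 size_eq0 => /eqP->; rewrite big_nil.
apply: (sub_finite_set _ (_ : finite_set ([set 1] `|`
  [set x * y | x in X & y in [set \prod_(y <- w) y | w in
    [set w : seq G | [set` w] `<=` X /\ size w <= n]]]))); last first.
  by rewrite finite_setU; split=> //; apply: finite_image2.
move=> _ [[|x w] [wX sw] <-]; first by left; rewrite big_nil.
right; exists x; first by apply: wX; rewrite /= mem_head.
exists (\prod_(y <- w) y); last by rewrite big_cons.
by exists w => //; split=> // z /= zw; apply: wX; rewrite /= inE zw orbT.
Qed.

Lemma dietzmann :
  finite_set X -> (forall x, X x -> ~ infinite_order x) ->
  finite_set (generated X).
Proof.
move=> Xfin Xtor; have [s sE] := (finite_seqP X).1 Xfin.
have [n n0 Xn] := finite_torsion_exponent Xfin Xtor.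
(* A letter of order dividing n has inverse a word, so words suffice; a word  *)
(* with n equal letters x can be shortened, since x ^+ n = 1.                 *)
pose W := [set \prod_(y <- w) y | w in [set w : seq G | [set` w] `<=` X]].
have Wgen : generated X `<=` W.
  apply: smallest_sub; last first.
    move=> x Xx; exists [:: x]; last by rewrite big_seq1.
    by move=> y /=; rewrite inE => /eqP->.
  split.
  - by exists [::]; rewrite ?big_nil.
  - move=> _ _ [u uX <-] [v vX <-]; exists (u ++ v); last by rewrite big_cat.
    by move=> z /=; rewrite mem_cat => /orP[/uX|/vX].
  (* Reverse the word and replace each letter x by n-1 copies, since x^(n-1) is the inverse of x. *)
  - move=> _ [u uX <-]; exists (flatten [seq nseq n.-1 x | x <- rev u]).
      move=> z /= /flattenP[_ /mapP[x xu ->]].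
      rewrite mem_nseq => /andP[_ /eqP->].
      by apply: uX; rewrite /= -mem_rev.
    elim: u uX => [|x u IH] uX; first by rewrite !big_nil invg1.
    rewrite rev_cons map_rcons flatten_rcons big_cat IH; last first.
      by move=> z /= zu; apply: uX; rewrite /= inE zu orbT.
    rewrite big_cons invgM; congr (_ * _).
    have xn : x ^+ n = 1 by apply/Xn/uX; rewrite /= mem_head.
    rewrite big_nseq iter_mulg_1; apply/esym/mulg1_eq.
    by rewrite -expgS prednK.
apply: (sub_finite_set _ (short_words_finite (size s * n)%N Xfin)).
move=> _ /Wgen[w wX <-]; have [m] := ubnP (size w).
elim: m w wX => // m IH w wX; rewrite ltnS => wm.
have [ws|sw] := leqP (size w) (size s * n)%N; first by exists w.
(* Otherwise each letter of [s] occurs fewer than n times, bounding the length by [size s * n]. *)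
have [x xc] : exists x, n <= count_mem x w.
  apply: contrapT => h; suff: size w <= (size s * n)%N by rewrite leqNgt sw.
  have ws : {subset w <= s} by move=> x xw; have := wX x xw; rewrite sE.
  apply: leq_trans (size_le_sum_count ws) _.
  rewrite -sum1_size big_distrl /=; apply: leq_sum => x _; rewrite mul1n.
  by rewrite leqNgt; apply/negP => /ltnW nx; apply: h; exists x.
have [w' [w'X ws wE]] := word_collect wX xc.
rewrite wE Xn ?mul1g.
  by apply: IH => //; apply: leq_trans wm; rewrite ws -add1n leq_add2r.
apply: wX => /=; rewrite -has_pred1 has_count; exact: leq_trans xc.
Qed.

End Dietzmann.

Theorem proposition4p2
  (G : groupType)
  (hG : forall g : G, ~ center G g -> infinite_order g ->
          infinite_set (conjugacy_class g))
  (A : groupType) (A_tf : torsion_free A) (A_ab : forall a b : A, commute a b)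
  (K : groupType)
  (iota : {multiplicative G -> (A * K)%type})
  (iota_inj : injective iota)
  (iota_index : finite_index (range iota))
  (hZ : set_inj (center G) (fun z : G => (iota z).1))
  (phi : formula 1) (phi_ex : existential phi) :
  concise phi G.
Proof.
have iM : {morph iota : x y / x * y} by exact: gmulfM.
have [n n0 nP] := finite_index_exponent (range_subgroup iM) iota_index.
have /choice[f fE] g : exists h, iota h = ((iota g).1 ^+ n.+1, (iota g).2).
  have [h _ hE] := nP ((iota g).1, 1).
  have XE (x : A * K) m : x ^+ m = (x.1 ^+ m, x.2 ^+ m).
    by elim: m => // m IH; rewrite !expgS IH.
  (* Here [h] maps to (a^n, 1), where a is the A-component of [g]. *)
  exists (g * h); rewrite iM hE XE expgS /= expg1n.
  by case: (iota g) => a k; congr pair; rewrite /= mulg1.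
have fM : {morph f : x y / x * y}.
  move=> x y; apply: iota_inj; rewrite iM !fE iM; congr pair => /=.
  by rewrite expgMn.
(* In an abelian group a^m = b^m gives (a/b)^m = 1, and [A] is torsion-free. *)
have AX_inj m : 0 < m -> injective (fun a : A => a ^+ m).
  move=> m0 a b /= ab; apply: divg1_eq; apply: contrapT => /A_tf/(_ _ m0).
  by rewrite expgnFl ?ab ?mulgV.
have f_inj : injective f.
  move=> x y /(congr1 iota); rewrite !fE => -[/AX_inj xy1 xy2].
  by apply: iota_inj; case: (iota x) (iota y) xy1 xy2 => ? ? [? ?] /= -> // ->.
move=> Xfin; set X := definable_set G phi in Xfin.
have XA g : X g -> (iota g).1 = 1.
  move=> Xg; apply: contrapT => a1.
  have XF i : X (iter i f g) by elim: i => // i; exact: definable_set_endo.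
  have FE i : (iota (iter i f g)).1 = (iota g).1 ^+ (n.+1 ^ i).
    by elim: i => // i IH; rewrite iterS fE /= IH -expgnA -expnSr.
  (* The iterates of [f] at [g] are solutions with A-components a^((n+1)^i), pairwise distinct as a
     has infinite order and n+1 > 1; so the naturals would inject into the finite set [X]. *)
  apply: infinite_nat.
  apply: (sub_finite_set _ (finite_preimage (f := fun i => iter i f g) _ Xfin)).
    by move=> i _; exact: XF.
  move=> i j _ _ /(congr1 (fun x => (iota x).1)); rewrite !FE => E.
  apply: (expnI (m := n.+1)) => //.
  wlog ij : i j E / i <= j => [hw|].
    by have [/hw->|/ltnW/hw->] := leqP i j.
  apply/eqP; rewrite eqn_leq leq_exp2l // ij /= leqNgt -subn_gt0.
  apply/negP => /(A_tf _ a1); apply.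
  by rewrite expgnFr ?leq_exp2l // E mulgV.
apply: dietzmann => //; first by move=> x y; exact: definable_setJ.
(* A central solution has trivial A-component, hence is 1 by [hZ]; a non-central one of infinite
   order would have an infinite conjugacy class inside [X]. *)
move=> x Xx xoo; have [Zx|nZx] := pselect (center G x).
  suff x1 : x = 1 by apply: (xoo 1%N) => //; rewrite x1 expg1n.
  apply: hZ; rewrite ?inE //; first by move=> g; exact/commute_sym/commute1.
  by rewrite (XA x Xx) (morphg1 iM).
apply: (hG x nZx xoo); apply: sub_finite_set Xfin => _ [g _ <-].
exact: definable_setJ.
Qed.
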